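(* Let $\ell>1$. Consider the problem $$\max_{\mathbf u_1,\dots,\mathbf u_\ell,\ \mathbf v_{\ell+1}}\ -\sum_{i=1}^{\ell}\langle\mathbf k_i,\mathbf u_i\rangle+\langle\boldsymbol\mu_\gamma,\log(\mathbf v_{\ell+1})\rangle\quad\text{subject to}\quad\sum_{i=1}^{\ell}\log(\mathbf u_i\otimes\mathbf 1)=\log(\mathbf v_{\ell+1}\otimes\mathbf 1),$$ where $\mathbf u_i$ is a tensor indexed by the variables in $c\cap c_i$ and $\mathbf v_{\ell+1}$ is a tensor indexed by the variables in $\gamma$. Its solution can be found by performing the following steps. 1. Calculate, from the largest intersection $c\cap c_1$ to the smallest $c\cap c_\ell$, $$\mathbf q_2=(\mathbf k_1\odot\mathbf k_2)^{1/2};\qquad \mathbf q_i=\big(P_{c\cap c_i}(\mathbf q_{i-1})^{\,i-1}\odot\mathbf k_i\big)^{1/i},\quad i=3,\dots,\ell.$$ 2. Calculate $\mathbf a_\ell,\dots,\mathbf a_2$ and $\mathbf v_{\ell+1},\mathbf v_\ell,\dots,\mathbf v_3$, from the smallest intersection $c\cap c_\ell$ to the largest $c\cap c_1$, as $$\mathbf v_{\ell+1}=(\boldsymbol\mu_\gamma\,./\,P_\gamma(\mathbf q_\ell))^{\ell},\qquad \mathbf a_i=(\mathbf v_{i+1}\otimes\mathbf 1)^{1/i}\odot\mathbf q_i\ \ (i=2,\dots,\ell),\qquad \mathbf v_i=(\mathbf a_i\,./\,P_{c\cap c_i}(\mathbf q_{i-1}))^{\,i-1}\ \ (i=3,\dots,\ell).$$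 3. Update $\mathbf u_1,\dots,\mathbf u_\ell$ as $$\mathbf u_1=\mathbf a_2\,./\,\mathbf k_1,\qquad \mathbf u_i=\mathbf a_i\,./\,\mathbf k_i\quad(i=2,\dots,\ell).$$
   Context: $V$ is a finite set of variables (nodes), each taking values in $\{1,\dots,d\}$. $c\subset V$ is a separator clique and $c_1,\dots,c_\ell\subset V$ its neighbouring cost cliques in a (modified) junction tree, ordered so that $(c\cap c_1)=(c\cap c_2)\supseteq(c\cap c_3)\supseteq\dots\supseteq(c\cap c_\ell)\supseteq\gamma$, where $\gamma\subseteq c$ is the set of variables whose joint marginal is constrained to the given probability tensor $\boldsymbol\mu_\gamma\in\mathbb R_+^{d^{|\gamma|}}$; if $c$ carries no constraint then $\gamma=\emptyset$, $\mathbf v_{\ell+1}$ is a scalar and $\boldsymbol\mu_\gamma=1$. Each $\mathbf k_i$ is a given, fixed tensor indexed by the variables in $c\cap c_i$, namely $\mathbf k_i=P_{c\cap c_i}(\mathbf K_{c_i}\odot\mathbf M_{c_i}\odot(\bar{\mathbf u}_i\otimes\mathbf 1))$, where $\mathbf K_{c_i}=\exp(-\mathbf C_{c_i}/\epsilon)$ for a cost tensor $\mathbf C_{c_i}$ on the variables $c_i$ and $\epsilon>0$, $\mathbf M_{c_i}$ is a fixed nonnegative reference tensor on $c_i$, and $\bar{\mathbf u}_i$ is the fixed positive scaling tensor associated with the other neighbouring separator of $c_i$; the entries of $\mathbf k_i$ and $\boldsymbol\mu_\gamma$ are positive. The variables $\mathbf u_i,\mathbf v_{\ell+1}$ are entrywise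 positive. For a tensor $\mathbf T$ on a variable set $A$ and $B\subseteq A$, $P_B(\mathbf T)$ is the tensor on $B$ obtained by summing $\mathbf T$ over all variables in $A\setminus B$. $\otimes\mathbf 1$ broadcasts a tensor to a tensor on a larger variable set (constant in the additional variables), the larger set being determined by the equation; in the constraint it is $c\cap c_1$. $\odot$, $./$, $\log$, $\exp$ and powers are entrywise, and $\langle\cdot,\cdot\rangle$ is the entrywise inner product. *)

(* Defs.v *)
From HB Require Import structures.
From mathcomp Require Import all_boot all_order all_algebra.
From mathcomp Require Import reals sequences exp.

Set Implicit Arguments.
Unset Strict Implicit.
Unset Printing Implicit Defensive.

Import Order.TTheory GRing.Theory Num.Theory.
Local Open Scope ring_scope.

(* Joint states of the variables in A. Every variable takes values in
   'I_d.+1 = {0, ..., d}, which stands for {1, ..., d.+1}: the number of values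
   is d.+1, so that it is never 0. There is exactly one element of conf d set0, so that tensors indexed
   by the empty set of variables are scalars. *)
Definition conf (V : finType) (d : nat) (A : {set V}) : finType :=
  {ffun {x : V | x \in A} -> 'I_d.+1}.

Definition tensor (R : realType) (V : finType) (d : nat) (A : {set V}) :=
  {ffun conf d A -> R}.

Section Tensors.
Variables (R : realType) (V : finType) (d : nat).
Implicit Types (A B : {set V}).

(* Restriction of a state of B to A. It is only meaningful for A \subset B; the
   default value ord0 is used only for variables outside B. *)
Definition restr A B (s : conf d B) : conf d A :=
  [ffun x : {x : V | x \in A} =>
     odflt ord0 (omap s (insub (val x) : option {y : V | y \in B}))].

(* P_B(T), for B \subset A. *)
Definition proj A B (T : tensor R d A) : tensor R d B :=
  [ffun t => \sum_(s : conf d A | restr B s == t) T s].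

(* T (x) 1 on the variable set B, for A \subset B. When A and B are equal but
   not convertible sets, this is the mere change of type. *)
Definition bcast A B (T : tensor R d A) : tensor R d B :=
  [ffun s => T (restr A s)].

Definition tmul A (T U : tensor R d A) : tensor R d A := [ffun s => T s * U s].
Definition tdiv A (T U : tensor R d A) : tensor R d A := [ffun s => T s / U s].
Definition tlog A (T : tensor R d A) : tensor R d A := [ffun s => ln (T s)].
Definition texp A (T : tensor R d A) : tensor R d A := [ffun s => expR (T s)].
Definition tpow A (T : tensor R d A) (r : R) : tensor R d A :=
  [ffun s => T s `^ r].
Definition dot A (T U : tensor R d A) : R := \sum_s T s * U s.
Definition tpos A (T : tensor R d A) : Prop := forall s, 0 < T s.

(* exp(- C / eps) *)
Definition gibbs A (C : tensor R d A) (eps : R) : tensor R d A :=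
  texp [ffun s => - C s / eps].

(* In the optimization problem below, S i is the intersection of the separator
   clique with the i-th cost clique. Families are indexed by nat, but only the
   indices 1 <= i <= l are relevant; w is the variable v_(l+1). *)
Section Problem.
Variables (l : nat) (S : nat -> {set V}) (gamma : {set V}).
Variables (k : forall i, tensor R d (S i)) (mu : tensor R d gamma).

Definition objective (u : forall i, tensor R d (S i)) (w : tensor R d gamma)
    : R :=
  - (\sum_(1 <= i < l.+1) dot (k i) (u i)) + dot mu (tlog w).

Definition feasible (u : forall i, tensor R d (S i)) (w : tensor R d gamma)
    : Prop :=
  [/\ forall i, (1 <= i <= l)%N -> tpos (u i),
      tpos w &
      \sum_(1 <= i < l.+1) tlog (bcast (S 1%N) (u i))
        = tlog (bcast (S 1%N) w)].

Definition is_maximizer (u : forall i, tensor R d (S i)) (w : tensor R d gamma)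
    : Prop :=
  feasible u w /\
  forall u' w', feasible u' w' -> objective u' w' <= objective u w.

Definition is_unique_maximizer
    (u : forall i, tensor R d (S i)) (w : tensor R d gamma) : Prop :=
  is_maximizer u w /\
  forall u' w', is_maximizer u' w' ->
    (forall i, (1 <= i <= l)%N -> u' i = u i) /\ w' = w.

Definition step1 (q : forall i, tensor R d (S i)) : Prop :=
  q 2%N = tpow (tmul (bcast (S 2%N) (k 1%N)) (k 2%N)) 2%:R^-1 /\
  forall i, (3 <= i <= l)%N ->
    q i = tpow (tmul (tpow (proj (S i) (q i.-1)) i.-1%:R) (k i)) i%:R^-1.

(* v i is relevant for 3 <= i <= l only; the equation for a_l is stated apart
   because v_(l+1) = w is indexed by gamma. *)
Definition step2 (q a v : forall i, tensor R d (S i)) (w : tensor R d gamma)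
    : Prop :=
  [/\ w = tpow (tdiv mu (proj gamma (q l))) l%:R,
      a l = tmul (tpow (bcast (S l) w) l%:R^-1) (q l),
      forall i, (2 <= i < l)%N ->
        a i = tmul (tpow (bcast (S i) (v i.+1)) i%:R^-1) (q i) &
      forall i, (3 <= i <= l)%N ->
        v i = tpow (tdiv (a i) (proj (S i) (q i.-1))) i.-1%:R].

Definition step3 (a u : forall i, tensor R d (S i)) : Prop :=
  u 1%N = tdiv (bcast (S 1%N) (a 2%N)) (k 1%N) /\
  forall i, (2 <= i <= l)%N -> u i = tdiv (a i) (k i).

(* (u, w) is an output of the three steps. *)
Definition computed_by_steps
    (u : forall i, tensor R d (S i)) (w : tensor R d gamma) : Prop :=
  exists q a v : forall i, tensor R d (S i),
    [/\ step1 q, step2 q a v w & step3 a u].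

End Problem.
End Tensors.

(* Main.v *)
(* Writing S_i = c \cap c_i, Lagrange duality attaches to the constraint a tensor
   lam on S_1, and the stationarity conditions read P_(S_i)(lam) = k_i u_i and
   P_gamma(lam) = mu. Given these, the inequality y (ln x - ln y) <= x - y, strict
   for x <> y, makes a feasible point the unique maximizer. The recursion is built
   so that P_(S_(i+1))(a_i) = a_(i+1) and P_gamma(a_l) = mu, so lam = a_2 works;
   and (ln a_m - ln q_m) m = \sum_(i <= m) ln u_i by induction on m, which for
   m = l is the constraint. *)
Require Import Defs.
From HB Require Import structures.
From mathcomp Require Import all_boot all_order all_algebra.
From mathcomp Require Import reals sequences exp.
From mathcomp Require Import ring zify.

Set Implicit Arguments.
Unset Strict Implicit.
Unset Printing Implicit Defensive.

Import Order.TTheory GRing.Theory Num.Theory.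
Local Open Scope ring_scope.

(** * Marginals and broadcasts of tensors *)

Section TensorTheory.
Variables (R : realType) (V : finType) (d : nat).
Implicit Types (A B D : {set V}).

Lemma restr_id A (s : conf d A) : restr A s = s.
Proof.
apply/ffunP => x; rewrite ffunE.
by case: insubP => [y _ /val_inj -> //|]; rewrite (valP x).
Qed.

Lemma restr_restr A B D (s : conf d D) :
  A \subset B -> restr A (restr B s) = restr A s.
Proof.
move=> /subsetP sAB; apply/ffunP => x; rewrite !ffunE.
case: insubP => [y _ yx|]; last by rewrite sAB ?(valP x).
by rewrite /= ffunE yx.
Qed.

(** [restr] towards a larger set extends a state by [ord0], which gives a section of the true
    restriction. Hence every fibre summed over by [proj] is inhabited. *)
Lemma restrK A B : A \subset B -> cancel (@restr V d B A) (@restr V d A B).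
Proof. by move=> sAB t; rewrite restr_restr // restr_id. Qed.

Lemma proj_gt0 A B (T : tensor R d B) :
  A \subset B -> tpos T -> tpos (proj A T).
Proof.
move=> sAB T_gt0 t; rewrite ffunE (bigD1 (restr B t)) /= ?restrK //.
by rewrite ltr_wpDr // sumr_ge0 // => s _; exact: ltW.
Qed.

Lemma proj_proj A B D (T : tensor R d D) :
  A \subset B -> proj A (proj B T) = proj A T.
Proof.
move=> sAB; apply/ffunP => t; rewrite !ffunE.
rewrite [RHS](partition_big (@restr V d B D) (fun r => restr A r == t)); last first.
  by move=> s; rewrite restr_restr.
apply: eq_bigr => r /eqP rt; rewrite ffunE; apply: eq_bigl => s.
apply/idP/andP => [/eqP sr|[]//]; split; last exact/eqP.
by rewrite -(restr_restr s sAB) sr rt.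
Qed.

(** The broadcast factor is constant on each fibre of [restr A], so it leaves the sum. This lets a
    scaling on a smaller set correct a marginal on it. *)
Lemma proj_bcast_mul A B (T : tensor R d A) (U : tensor R d B) :
  proj A (tmul (bcast B T) U) = tmul T (proj A U).
Proof.
apply/ffunP => t; rewrite !ffunE mulr_sumr.
by apply: eq_bigr => s /eqP st; rewrite !ffunE st.
Qed.

Lemma proj_id A (T : tensor R d A) : proj A T = T.
Proof.
apply/ffunP => t; rewrite ffunE (eq_bigl (pred1 t)) ?big_pred1_eq // => s.
by rewrite restr_id.
Qed.

(** Marginalising and broadcasting are adjoint. Pairings on the various [S i] can thus be moved to
    [S 1], where the constraint lives, and back. *)
Lemma dot_proj A B (T : tensor R d B) (U : tensor R d A) :
  dot (proj A T) U = dot T (bcast B U).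
Proof.
rewrite /dot (partition_big (@restr V d A B) predT) //=.
apply: eq_bigr => t _; rewrite ffunE mulr_suml.
by apply: eq_bigr => s /eqP st; rewrite ffunE st.
Qed.

Lemma dot_sumr A (I : Type) (r : seq I) (T : tensor R d A) (F : I -> tensor R d A) :
  dot T (\sum_(i <- r) F i) = \sum_(i <- r) dot T (F i).
Proof.
rewrite /dot exchange_big; apply: eq_bigr => s _.
by rewrite sum_ffunE mulr_sumr.
Qed.

Lemma tlog_bcast A B (T : tensor R d A) : tlog (bcast B T) = bcast B (tlog T).
Proof. by apply/ffunP => s; rewrite !ffunE. Qed.

Lemma tpowK A (T : tensor R d A) (n : nat) :
  (0 < n)%N -> tpos T -> tpow (tpow T n%:R) n%:R^-1 = T.
Proof.
move=> n0 T0; apply/ffunP => s; rewrite !ffunE -powRrM divff ?pnatr_eq0 -?lt0n //.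
by rewrite powRr1 // ltW.
Qed.

Lemma tpow_bcast A B (T : tensor R d A) r :
  tpow (bcast B T) r = bcast B (tpow T r).
Proof. by apply/ffunP => s; rewrite !ffunE. Qed.

Lemma tdivK A (T U : tensor R d A) : tpos U -> tmul (tdiv T U) U = T.
Proof. by move=> U0; apply/ffunP => s; rewrite !ffunE divfK // gt_eqF. Qed.

Lemma tdiv_gt0 A (T U : tensor R d A) : tpos T -> tpos U -> tpos (tdiv T U).
Proof. by move=> T0 U0 s; rewrite ffunE divr_gt0. Qed.

End TensorTheory.

(** This is [1 + t < expR t] at [t = ln x - ln y], scaled by [y]. *)
Lemma mulr_lnB_lt (R : realType) (x y : R) :
  0 < x -> 0 < y -> x != y -> y * (ln x - ln y) < x - y.
Proof.
move=> x0 y0 xy; have t0 : ln x - ln y != 0.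
  by rewrite subr_eq0; apply: contra xy => /eqP /ln_inj ->.
have := expR_gt1Dx t0; rewrite expRD expRN !lnK ?posrE // => h.
have -> : x - y = y * (x / y - 1) by field; rewrite gt_eqF.
by rewrite ltr_pM2l // ltrBrDl.
Qed.

(** * Optimality and uniqueness from a dual certificate *)

Section Duality.
Variables (R : realType) (V : finType) (d l : nat).
Variables (S : nat -> {set V}) (gamma : {set V}).
Variables (k : forall i, tensor R d (S i)) (mu : tensor R d gamma).
Hypothesis (k_gt0 : forall i, (1 <= i <= l)%N -> tpos (k i)).
Hypothesis sgS : gamma \subset S 1%N.
Variables (u : forall i, tensor R d (S i)) (w : tensor R d gamma).
Variable lam : tensor R d (S 1%N).
Hypothesis feas : feasible l u w.
Hypothesis proj_lam :
  forall i, (1 <= i <= l)%N -> proj (S i) lam = tmul (k i) (u i).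
Hypothesis proj_lam_gamma : proj gamma lam = mu.

(** Up to the weight [k i s], the generalised Kullback-Leibler divergence of [u i s] from
    [u' i s]. *)
Let gap (u' : forall i, tensor R d (S i)) i (s : conf d (S i)) : R :=
  k i s * (u' i s - u i s - u i s * (ln (u' i s) - ln (u i s))).

(** Since [mu] is a marginal of [lam], its pairing moves up to [S 1], the constraint splits it
    there, and each summand moves back down to [S i]. The weights involve only the reference point
    [u], whichever feasible point is tested. *)
Lemma dot_mu_log u' w' : feasible l u' w' ->
  dot mu (tlog w') = \sum_(1 <= i < l.+1) dot (tmul (k i) (u i)) (tlog (u' i)).
Proof.
case=> _ _ feas'; rewrite -proj_lam_gamma dot_proj -tlog_bcast -feas' dot_sumr.
by apply: eq_big_nat => i il; rewrite tlog_bcast -dot_proj proj_lam.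
Qed.

(** Both logarithmic terms now carry the same weights [k i * u i], so the difference decouples entry
    by entry. *)
Lemma objectiveB u' w' : feasible l u' w' ->
  objective l k mu u w - objective l k mu u' w' =
    \sum_(1 <= i < l.+1) \sum_s @gap u' i s.
Proof.
move=> feas'; rewrite /objective (dot_mu_log feas) (dot_mu_log feas').
rewrite opprD opprK addrACA -!sumrN -!big_split /=.
apply: eq_bigr => i _.
rewrite /dot -!sumrN -!big_split /=.
by apply: eq_bigr => s _; rewrite /gap !ffunE; ring.
Qed.

Lemma gap_gt0 u' (w' : tensor R d gamma) i (s : conf d (S i)) : (1 <= i <= l)%N -> feasible l u' w' ->
  u' i s != u i s -> 0 < @gap u' i s.
Proof.
move=> il [u'0 _ _] neq; have [u0 _ _] := feas.
rewrite mulr_gt0 ?k_gt0 // subr_gt0.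
by apply: mulr_lnB_lt => //; [exact: u'0 | exact: u0].
Qed.

Lemma gap_ge0 u' (w' : tensor R d gamma) i (s : conf d (S i)) : (1 <= i <= l)%N -> feasible l u' w' ->
  0 <= @gap u' i s.
Proof.
move=> il feas'; have [e|/(gap_gt0 il feas')/ltW//] := eqVneq (u' i s) (u i s).
by rewrite /gap e !subrr mulr0 subr0 mulr0.
Qed.

Lemma dual_certificate : is_unique_maximizer l k mu u w.
Proof.
have le_obj u' w' : feasible l u' w' -> objective l k mu u' w' <= objective l k mu u w.
  move=> feas'; rewrite -subr_ge0 objectiveB // big_nat.
  by apply: sumr_ge0 => i il; apply: sumr_ge0 => s _; apply: gap_ge0 feas'.
split=> // u' w' [feas' max'].
have eq_u i : (1 <= i <= l)%N -> u' i = u i.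
  move=> il; apply/ffunP => s; apply/eqP; apply: contraT => neq.
  (* Equal objectives make a sum of nonnegative gaps vanish, hence each gap, against the strict
     inequality at [s]. *)
  have : \sum_(1 <= i < l.+1) \sum_s @gap u' i s == 0.
    by rewrite -(objectiveB feas') subr_eq0 eq_le max' // le_obj.
  rewrite big_nat psumr_eq0 => [/allP /(_ i)|j jl]; last first.
    by apply: sumr_ge0 => t _; apply: gap_ge0 feas'.
  rewrite mem_index_iota ltnS il => /(_ isT) /eqP gap0.
  have := gap_gt0 il feas' neq.
  by rewrite (psumr_eq0P _ gap0) ?ltxx // => t _; apply: gap_ge0 feas'.
split=> //; apply/ffunP => t.
have [_ w0 feasE] := feas; have [_ w'0 feasE'] := feas'.
apply: ln_inj; rewrite ?posrE ?w0 ?w'0 //.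
have : tlog (bcast (S 1%N) w') = tlog (bcast (S 1%N) w).
  by rewrite -feasE -feasE'; apply: eq_big_nat => i il; rewrite eq_u.
(* The constraint is read at the extension of [t] to [S 1], which restricts back to [t] because
   [gamma] lies in [S 1]. *)
by move/ffunP/(_ (restr _ t)); rewrite !ffunE restrK.
Qed.

End Duality.

(** * Existence of an output of the three steps *)

Section Recursion.
Variables (R : realType) (V : finType) (d l : nat).
Variables (S : nat -> {set V}) (gamma : {set V}).
Variables (k : forall i, tensor R d (S i)) (mu : tensor R d gamma).
Hypothesis l_gt1 : (1 < l)%N.
Hypothesis S12 : S 1%N = S 2%N.
Hypothesis S_chain : forall i, (2 <= i < l)%N -> S i.+1 \subset S i.
Hypothesis sgS : gamma \subset S l.
Hypothesis k_gt0 : forall i, (1 <= i <= l)%N -> tpos (k i).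
Hypothesis mu_gt0 : tpos mu.

Lemma subset_chain i : (1 <= i <= l)%N -> S i \subset S 1%N.
Proof.
case: i => // -[//|] /=; elim=> [|i IHi] il; first by rewrite S12.
by apply: subset_trans (S_chain _) (IHi (ltnW il)).
Qed.

Lemma steps_exist :
  exists (u : forall i, tensor R d (S i)) (w : tensor R d gamma),
    computed_by_steps l k mu u w.
Proof.
(* The test [j == 1] singles out index 2; the values at 0 and 1 are fillers. *)
pose q := fix q i : tensor R d (S i) :=
  if i is j.+1 return tensor R d (S i) then
    if j == 1%N then tpow (tmul (bcast (S j.+1) (k 1%N)) (k j.+1)) 2%:R^-1
    else tpow (tmul (tpow (proj (S j.+1) (q j)) j%:R) (k j.+1)) j.+1%:R^-1
  else k 0%N.
pose w := tpow (tdiv mu (proj gamma (q l))) l%:R.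
pose vof (a : forall i, tensor R d (S i)) i : tensor R d (S i) :=
  tpow (tdiv (a i) (proj (S i) (q i.-1))) i.-1%:R.
(* Substituting [v] leaves one recursion for [a], sought as a fixed point of [F]: the entry at [l]
   depends on [w] alone, and any other entry only on the next index. *)
pose F (a : forall i, tensor R d (S i)) i : tensor R d (S i) :=
  tmul (tpow (if i == l then bcast (S i) w else bcast (S i) (vof a i.+1))
             i%:R^-1) (q i).
have FE x y i : (i != l -> x i.+1 = y i.+1) -> F x i = F y i.
  by rewrite /F /vof; case: (i == l) => [_|->].
(* The downward recursion for a is solved by iteration: the i-th entry of
   [iter n F k] is stationary as soon as n > l - i. *)
have iterF n i : (i <= l < i + n)%N -> F (iter n F k) i = iter n F k i.
  elim: n i => [|n IHn] i; first by rewrite addn0 ltnNge andbN.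
  move=> /andP[il ln]; rewrite [iter n.+1 F k]iterS; apply: FE => neq.
  by rewrite IHn //; lia.
(* The seed [k] is arbitrary; [l] rounds settle every index from 1 to [l]. *)
pose a := iter l F k.
have aE i : (2 <= i <= l)%N -> a i = F a i.
  by move=> il; rewrite /a iterF //; lia.
pose u i : tensor R d (S i) :=
  if i == 1%N then tdiv (bcast (S i) (a 2%N)) (k i) else tdiv (a i) (k i).
exists u, w, q, a, (vof a); split.
- split=> // -[//|i] il; rewrite /q -/q.
  by have /negPf -> : i != 1%N by lia.
- split=> //.
  + by rewrite aE /F ?eqxx // l_gt1 leqnn.
  + move=> i il; rewrite aE /F; last by lia.
    by have /negPf -> : i != l by lia.
- split=> // i il; rewrite /u.
  by have /negPf -> : i != 1%N by lia.
Qed.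

(** * Positivity, marginals and feasibility of an output *)

Section Steps.
Variables (q a v u : forall i, tensor R d (S i)) (w : tensor R d gamma).
Hypotheses (hq : step1 l k q) (haw : step2 l mu q a v w) (hu : step3 l k a u).

Lemma q_gt0 i : (2 <= i <= l)%N -> tpos (q i).
Proof.
case: i => // -[//|] /=; have [q2 qS] := hq.
elim=> [|i IHi] il s.
  by rewrite q2 !ffunE powR_gt0 // mulr_gt0 // k_gt0 //= ltnW.
rewrite qS // 3!ffunE powR_gt0 // mulr_gt0 ?k_gt0 // powR_gt0 //.
by apply: proj_gt0; [exact: S_chain | exact: IHi (ltnW il)].
Qed.

Lemma proj_q_gt0 i : (2 <= i < l)%N -> tpos (proj (S i.+1) (q i)).
Proof.
move=> il; apply: proj_gt0; first exact: S_chain.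
by apply: q_gt0; lia.
Qed.

Lemma proj_q_gamma_gt0 : tpos (proj gamma (q l)).
Proof. by apply: proj_gt0 => //; apply: q_gt0; rewrite l_gt1 leqnn. Qed.

Lemma w_gt0 : tpos w.
Proof.
by case: haw => -> _ _ _ s; rewrite 2!ffunE powR_gt0 // divr_gt0 // proj_q_gamma_gt0.
Qed.

(** Each [a i] is computed from [a i.+1] through [v i.+1], so the induction descends from [l], on
    [l - i]. *)
Lemma a_gt0 i : (2 <= i <= l)%N -> tpos (a i).
Proof.
have [_ al aS vS] := haw.
have [n] := ubnP (l - i); elim: n i => // n IHn i lin i2l.
case: (eqVneq i l) => [->|neq] s.
  by rewrite al !ffunE mulr_gt0 ?powR_gt0 ?w_gt0 // q_gt0 // l_gt1 /=.
have il : (2 <= i < l)%N by lia.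
rewrite aS // !ffunE mulr_gt0 ?q_gt0 // powR_gt0 // vS //.
rewrite 2!ffunE powR_gt0 // divr_gt0 //; first by apply: IHn; lia.
by apply: proj_q_gt0; lia.
Qed.

Lemma u_gt0 i : (1 <= i <= l)%N -> tpos (u i).
Proof.
have [u1 uS] := hu; move=> /[dup] il /andP[]; rewrite leq_eqVlt.
case/predU1P => [<-|i2] il' s.
  by rewrite u1 !ffunE divr_gt0 ?k_gt0 ?a_gt0 //; lia.
by rewrite uS ?i2 // !ffunE divr_gt0 ?k_gt0 ?a_gt0 ?i2.
Qed.

(** The scaling of [q i] in [a i] is the broadcast of [a i.+1] divided by the marginal of [q i]; it
    leaves the projection and cancels that marginal. *)
Lemma proj_a_succ i : (2 <= i < l)%N -> proj (S i.+1) (a i) = a i.+1.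
Proof.
have [_ _ aS vS] := haw => il.
have P0 := proj_q_gt0 il.
have a0 : tpos (a i.+1) by apply: a_gt0; lia.
rewrite aS // tpow_bcast vS; last by lia.
rewrite /= tpowK; [|by lia|exact: tdiv_gt0].
by rewrite proj_bcast_mul tdivK.
Qed.

(** The same cancellation, with [w] and [mu] in the roles of [v i.+1] and [a i.+1]. *)
Lemma proj_a_gamma : proj gamma (a l) = mu.
Proof.
have [wE al _ _] := haw; have P0 := proj_q_gamma_gt0.
rewrite al tpow_bcast wE tpowK; [|by lia|exact: tdiv_gt0].
by rewrite proj_bcast_mul tdivK.
Qed.

Lemma proj_a2 i : (2 <= i <= l)%N -> proj (S i) (a 2%N) = a i.
Proof.
case: i => // -[//|] /=; elim=> [|i IHi] il; first exact: proj_id.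
by rewrite -(@proj_a_succ i.+2) // -IHi ?(ltnW il) // proj_proj // S_chain.
Qed.

Lemma proj_bcast_a2 A :
  proj A (bcast (S 1%N) (a 2%N)) = proj A (a 2%N).
Proof.
(* Detached from its family, the tensor can have its type rewritten from [S 2] to [S 1], after which
   the broadcast is the identity. *)
move: (a 2%N); rewrite -S12 => T; congr proj.
by apply/ffunP => s; rewrite ffunE restr_id.
Qed.

Lemma ln_scaling_prod m (s : conf d (S 1%N)) : (2 <= m <= l)%N ->
  \sum_(1 <= i < m.+1) ln (u i (restr _ s)) =
    m%:R * (ln (a m (restr _ s)) - ln (q m (restr _ s))).
Proof.
have [_ _ aS vS] := haw; have [q2 qS] := hq; have [u1 uS] := hu.
have pos i (t : conf d (S i)) : (1 <= i <= l)%N -> k i t \is Num.pos.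
  by move=> il; rewrite posrE k_gt0.
case: m => // -[//|] /=; elim=> [|m IHm] ml.
  (* Base case: [u 1 * u 2] is the square of [a 2] over [k 1 * k 2], and the latter product is the
     square of [q 2]. *)
  rewrite 2?big_nat_recr //= big_geq // add0r u1 uS // q2 !ffunE.
  have e : restr (S 1%N) (restr (S 2%N) s) = restr (S 1%N) s.
    by rewrite restr_restr // S12.
  have a2 t : a 2%N t \is Num.pos by rewrite posrE a_gt0.
  have l1 : (1 <= 1 <= l)%N by lia.
  rewrite e restr_restr -?S12 // ln_powR !ln_div ?pos // !restr_id lnM ?pos //.
  by field.
rewrite big_nat_recr //= IHm ?(ltnW ml) // uS // (qS m.+3) //= 4!ffunE.
set t := restr (S m.+3) s; rewrite ln_powR.
have P0 : proj (S m.+3) (q m.+2) t \is Num.pos.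
  by rewrite posrE proj_q_gt0.
have a0 : a m.+3 t \is Num.pos by rewrite posrE a_gt0.
rewrite ln_div ?pos // lnM ?pos // ?posrE ?powR_gt0 // ln_powR.
(* Both sides are the logarithm of the scaling that takes [q m.+2] to [a m.+2]. After this, the
   definition of [q m.+3] trades its marginal and [k m.+3] for [m.+3] copies of [ln q]. *)
have -> : ln (a m.+2 (restr _ s)) - ln (q m.+2 (restr _ s))
   = ln (a m.+3 t) - ln (proj (S m.+3) (q m.+2) t).
  have d0 : tpos (tdiv (a m.+3) (proj (S m.+3) (q m.+2))).
    by apply: tdiv_gt0; [apply: a_gt0|apply: proj_q_gt0].
  rewrite aS // ffunE tpow_bcast vS //= tpowK // ffunE restr_restr ?S_chain //.
  by rewrite -/t lnM ?addrK ?posrE ?q_gt0 ?(ltnW ml) // ffunE ln_div.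
by rewrite [RHS]mulrBr mulVKf ?pnatr_eq0 //; ring.
Qed.

(** At [m = l] the ratio of [a l] to [q l] is the [l]-th root of the broadcast of [w], so [l] times
    its logarithm is [ln w]. *)
Lemma steps_feasible : feasible l u w.
Proof.
split; [exact: u_gt0 | exact: w_gt0 |].
apply/ffunP => s; rewrite sum_ffunE.
under eq_bigr do rewrite 2!ffunE.
rewrite ln_scaling_prod ?l_gt1 ?leqnn // !ffunE.
have [wE al _ _] := haw; have P0 := proj_q_gamma_gt0.
have l0 : l%:R != 0 :> R by rewrite pnatr_eq0 -lt0n ltnW.
have q0 : q l (restr (S l) s) \is Num.pos by rewrite posrE q_gt0 // l_gt1 /=.
rewrite al !ffunE restr_restr // lnM ?posrE ?powR_gt0 ?w_gt0 //.
by rewrite addrK ln_powR mulVKf.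
Qed.

Lemma steps_unique_maximizer : is_unique_maximizer l k mu u w.
Proof.
have [u1 uS] := hu.
have sgS1 : gamma \subset S 1%N.
  by apply: subset_trans sgS (subset_chain _); rewrite leqnn ltnW.
(* The multiplier is [a 2], carried to the type of tensors on [S 1]. As [k i * u i] is [a i] ([a 2]
   when [i = 1]), stationarity says that the [a i] are its marginals. *)
apply: (@dual_certificate _ _ _ _ _ _ _ _ k_gt0 sgS1 u w (bcast (S 1%N) (a 2%N))).
- exact: steps_feasible.
- have kK i (T : tensor R d (S i)) : (1 <= i <= l)%N -> tmul (k i) (tdiv T (k i)) = T.
    move=> il; apply/ffunP => s; rewrite !ffunE mulrC divfK // gt_eqF //.
    exact: k_gt0.
  move=> i /[dup] il /andP[]; rewrite leq_eqVlt => /predU1P[<- _|i2 il'].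
    by rewrite u1 kK ?proj_id //= ltnW.
  by rewrite uS ?i2 // kK // proj_bcast_a2 proj_a2 ?i2.
- by rewrite proj_bcast_a2 -(proj_proj (B := S l)) // proj_a2 ?proj_a_gamma ?l_gt1 /=.
Qed.

End Steps.
End Recursion.

(** The first half ensures that the second, which covers every output of the steps, is not
    vacuous. *)
Theorem proposition4p6 (R : realType) (V : finType) (d l : nat)
    (c : {set V}) (C : nat -> {set V}) (gamma : {set V})
    (sep : nat -> {set V}) (eps : R)
    (cost M : forall i : nat, tensor R d (C i))
    (ubar : forall i : nat, tensor R d (sep i))
    (k : forall i : nat, tensor R d (c :&: C i))
    (mu : tensor R d gamma)
    (hl : (1 < l)%N)
    (h12 : c :&: C 1%N = c :&: C 2%N)
    (hchain : forall i : nat, (2 <= i < l)%N -> c :&: C i.+1 \subset c :&: C i)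
    (hgamma : gamma \subset c :&: C l)
    (heps : 0 < eps)
    (hM : forall i : nat, (1 <= i <= l)%N -> forall s, 0 <= M i s)
    (hsep : forall i : nat, (1 <= i <= l)%N -> sep i \subset C i)
    (hubar : forall i : nat, (1 <= i <= l)%N -> tpos (ubar i))
    (hk : forall i : nat, (1 <= i <= l)%N ->
       k i = proj (c :&: C i)
               (tmul (tmul (gibbs (cost i) eps) (M i))
                     (bcast (C i) (ubar i))))
    (hkpos : forall i : nat, (1 <= i <= l)%N -> tpos (k i))
    (hmupos : tpos mu)
    (hmuprob : \sum_s mu s = 1) :
  (exists (u : forall i : nat, tensor R d (c :&: C i)) (w : tensor R d gamma),
     computed_by_steps l k mu u w) /\
  (forall (u : forall i : nat, tensor R d (c :&: C i)) (w : tensor R d gamma),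
     computed_by_steps l k mu u w -> is_unique_maximizer l k mu u w).
Proof.
pose S i := c :&: C i.
split; first exact: (@steps_exist R V d l S gamma k mu hl).
move=> u w [q [a [v [hq haw hu]]]].
exact: (@steps_unique_maximizer R V d l S gamma k mu hl h12 hchain hgamma hkpos
  hmupos q a v u w hq haw hu).
Qed.
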